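(* Let $L\subset\mathbb{R}P^n$ be a projective line and let $A\subset\mathbb{R}P^n$ be an $L$-convex-concave set. Let $a_1,a_2,a_3,a_4$ be four distinct points lying on $L$ in this cyclic order; they divide $L$ into four pairwise disjoint open intervals $\langle a_1,a_2\rangle,\langle a_2,a_3\rangle,\langle a_3,a_4\rangle,\langle a_4,a_1\rangle$. Let $I_1=L\setminus\langle a_1,a_2\rangle$, $I_2=L\setminus\langle a_2,a_3\rangle$, $I_3=L\setminus\langle a_3,a_4\rangle$, $I_4=L\setminus\langle a_4,a_1\rangle$ be the complementary closed segments. Suppose that for every two-dimensional plane $N\supset L$ the section $A\cap N$ is pointed with respect to each of the four segments $I_1,\dots,I_4$. Then $A$ contains a projective subspace of dimension $n-2$.
   Context: For a projective subspace $T\subset\mathbb{R}P^n$, $\mathbb{R}P^n/T$ is the projective space of dimension $n-\dim T-1$ whose points are the $(\dim T+1)$-dimensional subspaces containing $T$; the projection from the center $T$ sends $x\notin T$ to the span of $x$ and $T$. A nonempty subset of a projective space is convex if it is disjoint from some hyperplane $H$ and is convex in the affine space obtained by removing $H$. A closed set $A\subset\mathbb{R}P^n$ is $L$-convex-concave if: 1) $A\cap L=\emptyset$; 2) for every $(\dim L+1)$-dimensional subspace $N\supset L$ the section $A\cap N$ is convex; 3) for every $(\dim L-1)$-dimensional subspace $T\subset L$ the complement in $\mathbb{R}P^n/T$ of the projection of $A$ from the center $T$ is an open convex set. Pointedness: let $N$ be a projective space, $L\subset N$ a hyperplane, $\Delta\subset L$ a closed convex set. Choose an origin in the affine space $N\setminus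 L$, making it a linear space. The union of all lines through the origin whose points at infinity (in $L$) lie in $\Delta$ has the form $K\cup(-K)$, where $K$ is a closed convex cone containing no line. A connected set $S\subset N\setminus L$ is pointed with respect to $\Delta$ if there are points $a,b\in S$ (its vertices) such that $S\subset a+K$ and $S\subset b-K$. *)

(* Defs.v *)
From HB Require Import structures.
From mathcomp Require Import all_boot all_order all_algebra.
From mathcomp Require Import all_classical all_reals all_analysis.
Set Implicit Arguments.
Unset Strict Implicit.
Unset Printing Implicit Defensive.
Import Order.TTheory GRing.Theory Num.Theory.
Import numFieldNormedType.Exports.
Local Open Scope classical_set_scope.
Local Open Scope ring_scope.

(* A projective subspace of RP^n of dimension d is a linear subspace of
   R^(n+1) of dimension d.+1; the zero subspace is the empty projective
   subspace, of dimension -1. *)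

(* The projective space RP^n/T: its points are the subspaces containing T of
   dimension one more than T. *)
Definition quotproj (R : realType) (n : nat) (T : {vspace 'rV[R]_n.+1}) : Type :=
  {W : {vspace 'rV[R]_n.+1} | (T <= W)%VS && (\dim W == (\dim T).+1)}.

(* RP^n itself is RP^n/T for T empty. *)
Notation RP R n := (@quotproj R n 0%VS).

Section ProjectiveSpace.
Variables (R : realType) (n : nat).
Implicit Types (T L N H : {vspace 'rV[R]_n.+1}).

HB.instance Definition _ T := Choice.on (quotproj T).

Definition points T N : set (quotproj T) := [set p | (val p <= N)%VS].

(* The vectors lying on some point of S. *)
Definition vectors T (S : set (quotproj T)) : set 'rV[R]_n.+1 :=
  \bigcup_(p in S) [set v | v \in val p].

(* The topology of RP^n/T is the quotient topology for the map from R^(n+1) \ T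
   sending v to <v> + T. *)
Definition quotproj_open T (S : set (quotproj T)) : Prop :=
  open (vectors S `\` [set v | v \in T]).

Lemma dimv_add_line T (v : 'rV[R]_n.+1) :
  v \notin T -> \dim (T + <[v]>)%VS = (\dim T).+1.
Proof.
move=> vT; rewrite dimv_disjoint_sum.
  by rewrite dim_vline; case: eqP vT => [->|_ _]; rewrite ?mem0v ?addn1.
apply/eqP; rewrite -subv0; apply/subvP => x; rewrite memv_cap memv0.
case/andP=> xT /vlineP[k xE]; rewrite xE scaler_eq0.
have [//|k0] := eqVneq k 0.
by case/negP: vT; rewrite -[v](scalerK k0) -xE memvZ.
Qed.

Lemma quotproj_inj T (p q : quotproj T) (v : 'rV[R]_n.+1) :
  v \notin T -> v \in val p -> v \in val q -> p = q.
Proof.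
move=> vT.
have E (r : quotproj T) : v \in val r -> (T + <[v]>)%VS = val r.
  case: r => W /= /andP[TW /eqP dW] vW; apply/eqP.
  by rewrite eqEdim subv_add TW -memvE vW /= dW dimv_add_line.
by move=> /E Ep /E Eq; apply: val_inj; rewrite -Ep -Eq.
Qed.

Lemma continuous_linear_comb (X : topologicalType) (I : Type) (r : seq I)
    (F : I -> X -> R) (c : I -> R) :
  (forall i, continuous (F i)) ->
  continuous (fun x => \sum_(i <- r) F i x * c i).
Proof.
move=> cF x; elim: r => [|i r IHr].
  rewrite (_ : (fun _ => _) = cst 0); first exact: cst_continuous.
  by apply/funext => y; rewrite big_nil.
rewrite (_ : (fun _ => _) = (fun y => F i y * c i + \sum_(k <- r) F k y * c k)).
  by apply: cvgD => //; apply: cvgMr_tmp; exact: cF.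
by apply/funext => y; rewrite big_cons.
Qed.

Lemma closed_vspace T : closed [set v : 'rV[R]_n.+1 | v \in T].
Proof.
have -> : [set v : 'rV[R]_n.+1 | v \in T] =
    \bigcap_(j in [set: 'I_n.+1])
      ((fun v => (v - projv T v) ord0 j) @^-1` [set 0]).
  apply/seteqP; split=> v /=.
    by move=> vT j _ /=; rewrite projv_id// subrr mxE.
  move=> h; have /eqP : v - projv T v = 0.
    by apply/rowP => j; rewrite (h j I) mxE.
  by rewrite subr_eq0 => /eqP ->; rewrite memv_proj.
apply: closed_bigI => j _; apply: preimage_closed; last first.
  exact/accessible_closed_set1/hausdorff_accessible/Rhausdorff.
pose f (v : 'rV[R]_n.+1) : R := (v - projv T v) ord0 j.
have -> : (fun v => (v - projv T v) ord0 j) =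
    (fun v : 'rV[R]_n.+1 => \sum_(i < n.+1) v ord0 i * f (delta_mx ord0 i)).
  apply/funext => v; rewrite {1 2}(row_sum_delta v) linear_sum /= -sumrB summxE.
  by apply: eq_bigr => i _; rewrite linearZ /= -scalerBr mxE.
by move=> v _; apply: continuous_linear_comb => i; exact: coord_continuous.
Qed.

Lemma quotproj_openT T : quotproj_open [set: quotproj T].
Proof.
rewrite /quotproj_open.
have -> : vectors [set: quotproj T] `\` [set v | v \in T] =
    ~` [set v | v \in T].
  apply/seteqP; split=> v /=; first by case.
  move=> vT; split=> //.
  have hW : (T <= T + <[v]>)%VS && (\dim (T + <[v]>)%VS == (\dim T).+1).
    by rewrite addvSl dimv_add_line ?eqxx//; exact/negP.
  exists (Sub (T + <[v]>)%VS hW : quotproj T) => //=.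
  by rewrite (subvP (addvSr _ _))// memv_line.
exact/closed_openC/closed_vspace.
Qed.

Lemma quotproj_openI T : setI_closed (@quotproj_open T).
Proof.
move=> A B oA oB; rewrite /quotproj_open.
have -> : vectors (A `&` B) `\` [set v | v \in T] =
   (vectors A `\` [set v | v \in T]) `&` (vectors B `\` [set v | v \in T]).
  apply/seteqP; split=> v /=.
    by case=> -[p [Ap Bp] vp] vT; split; split=> //; exists p.
  case=> -[[p Ap vp] vT] [[q Bq vq] _]; split=> //; exists p => //; split=> //.
  by rewrite (quotproj_inj _ vp vq)//; apply/negP.
exact: openI.
Qed.

Lemma quotproj_open_bigU T (I : Type) (f : I -> set (quotproj T)) :
  (forall i, quotproj_open (f i)) -> quotproj_open (\bigcup_i f i).
Proof.
move=> of_; rewrite /quotproj_open.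
have -> : vectors (\bigcup_i f i) `\` [set v | v \in T] =
    \bigcup_i (vectors (f i) `\` [set v | v \in T]).
  apply/seteqP; split=> v /=.
    by case=> -[p [i _ fip] vp] vT; exists i => //; split=> //; exists p.
  by case=> i _ [[p fip vp] vT]; split=> //; exists p => //; exists i.
by apply: bigcup_open => i _; exact: of_.
Qed.

HB.instance Definition _ T := isOpenTopological.Build (quotproj T)
  (@quotproj_openT T) (@quotproj_openI T) (@quotproj_open_bigU T).

Lemma open_quotprojE T : open = @quotproj_open T.
Proof. by []. Qed.

(* Let H be a hyperplane of the projective space N/T, and o a vector of N
   outside H. The map sending u in H to the point of N/T containing o + u is an
   affine map from H onto the affine space N/T \ H/T, with the cosets of T as
   fibers; it takes 0 to the point of o, the chosen origin, and for T = 0 it is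
   a bijection. [chart H o S] is the preimage of S. *)
Definition chart T H (o : 'rV[R]_n.+1) (S : set (quotproj T)) :
    set 'rV[R]_n.+1 :=
  [set u | u \in H /\ vectors S (o + u)].

(* S is a convex subset of the projective space N/T. *)
Definition proj_convex T N (S : set (quotproj T)) : Prop :=
  [/\ S !=set0, S `<=` points N &
      exists H, [/\ (T <= H <= N)%VS, (\dim H).+1 = \dim N,
        S `&` points H = set0 &
        exists o, [/\ o \in N, o \notin H &
          convex_set (chart H o S : set (convex_lmodType 'rV[R]_n.+1))]]].

(* A point p off T is sent to the span of p and T. *)
Definition projection T (A : set (RP R n)) : set (quotproj T) :=
  [set q | exists p, [/\ A p, ~~ (val p <= T)%VS & val q = (val p + T)%VS]].
Arguments projection T A : clear implicits.

Definition L_convex_concave L (A : set (RP R n)) : Prop :=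
  [/\ closed A,
      A `&` points L = set0,
      forall N, (L <= N)%VS -> \dim N = (\dim L).+1 ->
        proj_convex N (A `&` points N) &
      forall T, (T <= L)%VS -> (\dim T).+1 = \dim L ->
        open (~` projection T A) /\ proj_convex fullv (~` projection T A)].

(* Once an origin o is chosen, the linear space N \ L is identified with the
   vector space L by the chart. The point at infinity of the line through the
   origin spanned by u in L is then the point <u> of L, so [vectors Delta] is
   the union of the lines whose points at infinity lie in Delta. These
   conditions determine K up to sign, and replacing K by -K merely exchanges
   the vertices a and b below. *)
Definition half_cone (Delta : set (RP R n)) (K : set 'rV[R]_n.+1) : Prop :=
  [/\ closed K,
      convex_set (K : set (convex_lmodType 'rV[R]_n.+1)),
      forall (t : R) u, 0 <= t -> K u -> K (t *: u),
      forall x u, (forall t : R, K (x + t *: u)) -> u = 0 &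
      vectors Delta = K `|` [set u | K (- u)]].

(* S is pointed with respect to Delta, a subset of the hyperplane L of N. *)
Definition pointed N L (Delta S : set (RP R n)) : Prop :=
  [/\ connected S, S `<=` points N `\` points L &
      exists o K, [/\ o \in N, o \notin L, half_cone Delta K &
        exists a b, [/\ chart L o S a, chart L o S b &
          forall u, chart L o S u -> K (u - a) /\ K (b - u)]]].

(* The points of the open segment from <v> to <w> swept out by the positive
   combinations of v and w. The other open segment between these two points
   is [open_segment v (- w)]. *)
Definition open_segment (v w : 'rV[R]_n.+1) : set (RP R n) :=
  [set p : RP R n | exists s t : R, [/\ 0 < s, 0 < t & s *: v + t *: w \in val p]].

(* c and d lie in different components of the line ab minus {a, b}. *)
Definition separates (a b c d : RP R n) : Prop :=
  a != b /\
  exists v w, [/\ val a = <[v]>%VS, val b = <[w]>%VS,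
    open_segment v w c & open_segment v (- w) d].

Definition cyclic_order (a1 a2 a3 a4 : RP R n) : Prop :=
  uniq [:: a1; a2; a3; a4] /\ separates a1 a3 a2 a4.

(* The open interval with endpoints a and b, on the line ab, that does not
   contain the point c of this line. *)
Definition interval_avoiding (a b c : RP R n) : set (RP R n) :=
  [set x | separates a b c x].

End ProjectiveSpace.

Arguments projection {R n} T A _.

(* Main.v *)
From HB Require Import structures.
Require Import Defs.
From mathcomp Require Import all_boot all_order all_algebra.
From mathcomp Require Import all_classical all_reals all_analysis.
From mathcomp Require Import ring lra.
Set Implicit Arguments.
Unset Strict Implicit.
Unset Printing Implicit Defensive.
Import Order.TTheory GRing.Theory Num.Theory.
Local Open Scope classical_set_scope.
Local Open Scope ring_scope.

(** Write R^(n+1) as L + C. The fibers S(v) of the cone over A above v in C are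
compact convex sets of L, and L-convex-concavity makes the support function
M_phi(v) = max_S(v) phi of S(v) sublinear in v, for every linear form phi on L
vanishing on one of the a_i. A subspace of dimension n - 2 in A is the graph of
a linear map F : C -> L with F v in S(v). Since S(v) is pointed with respect to
the four segments, it is an octagon with sides parallel to the a_i, so this
amounts to phi_i (F v) <= M_i v for four forms phi_1, ..., phi_4 vanishing on
a_1, ..., a_4. By Hahn-Banach such an F exists as soon as
sum_i phi_i (x) v_i = 0 implies sum_i M_i v_i >= 0. In this case v_2 and v_4 are
linear combinations of v_1 and v_3, and evaluating the relation at a point of
S(v_3) extremal for phi_2 and at a point of S(v_1) extremal for phi_4 gives the
inequality. *)

(** * Sublinear functions and a finite-dimensional Hahn-Banach theorem *)

Section Sublinear.
Variable R : realType.

Definition sublinear (E : lmodType R) (p : E -> R) : Prop :=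
  (forall x y, p (x + y) <= p x + p y) /\
  (forall c x, 0 < c -> p (c *: x) <= c * p x).

Section Basic.
Variables (E : lmodType R) (p : E -> R).
Hypothesis p_sub : sublinear p.

Lemma sublinearZ c x : 0 < c -> p (c *: x) = c * p x.
Proof.
move=> c0; apply/eqP; rewrite eq_le p_sub.2//= -ler_pdivlMl//.
by rewrite -{1}[x](scalerK (lt0r_neq0 c0)) p_sub.2// invr_gt0.
Qed.

Lemma sublinear0 : p 0 = 0.
Proof.
have := sublinearZ 0 (ltr0Sn R 1); rewrite scaler0 => h; lra.
Qed.

Lemma sublinearN_ge x : - p x <= p (- x).
Proof. by rewrite -subr_ge0 opprK -sublinear0 -(addNr x) p_sub.1. Qed.

End Basic.

(** The relation [P] is a convex cone in the product of E and R, and its lower boundary is a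
    sublinear function. Adding an element over x to one over [- x] gives an element over 0, which
    bounds each [P x] from below. *)
Lemma inf_sublinear (E : lmodType R) (P : E -> set R) :
  (forall x, P x !=set0) ->
  (forall x y r s, P x r -> P y s -> P (x + y) (r + s)) ->
  (forall c x r, 0 < c -> P x r -> P (c *: x) (c * r)) ->
  (forall r, P 0 r -> 0 <= r) ->
  sublinear (fun x => inf (P x)) /\ (forall x r, P x r -> inf (P x) <= r).
Proof.
move=> P0 PD PZ Pge0.
have lbP x : has_lbound (P x).
  have [s Ps] := P0 (- x); exists (- s) => r Pr.
  by have := Pge0 (r + s); rewrite -(subrr x) => /(_ (PD _ _ _ _ Pr Ps)) h; lra.
have infP x r : P x r -> inf (P x) <= r by move=> Pr; apply: ge_inf.
split=> //; split=> [x y|c x c0].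
  rewrite -lerBlDr; apply: lb_le_inf => // r Pr.
  rewrite lerBlDr -lerBlDl; apply: lb_le_inf => // s Ps.
  by rewrite lerBlDl infP//; apply: PD.
rewrite -ler_pdivrMl//; apply: lb_le_inf => // r Pr.
by rewrite ler_pdivrMl// infP//; apply: PZ.
Qed.

(** One step of Hahn-Banach, done by lowering [p] instead of extending a form: [q x] is the infimum
    of [p (x + t *: e) - t * p e] over [t >= 0]. Taking [t = 1] at [- e] gives
    [q (- e) <= - p e <= - q e]; the reverse inequality holds for every sublinear function. *)
Lemma sublinear_linear_along (E : lmodType R) (p : E -> R) (e : E) :
  sublinear p -> exists q : E -> R,
    [/\ sublinear q, forall x, q x <= p x & q (- e) = - q e].
Proof.
move=> p_sub.
have pZ c x : 0 <= c -> p (c *: x) = c * p x.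
  rewrite le_eqVlt => /orP[/eqP <-|c0]; last exact: sublinearZ.
  by rewrite scale0r mul0r sublinear0.
pose P x := [set r | exists2 t, 0 <= t & p (x + t *: e) - t * p e <= r].
have [||||q_sub qP] := @inf_sublinear E P.
- by move=> x; exists (p (x + 0 *: e) - 0 * p e); exists 0.
- move=> x y r s [t t0 tr] [u u0 us].
  exists (t + u); first exact: addr_ge0.
  have := p_sub.1 (x + t *: e) (y + u *: e).
  by rewrite addrACA -scalerDl; lra.
- move=> c x r c0 [t t0 tr].
  exists (c * t); first by rewrite mulr_ge0// ltW.
  by rewrite -scalerA -scalerDr sublinearZ// -mulrA -mulrBr ler_pM2l.
- by move=> r [t t0]; rewrite add0r pZ//; lra.
have P'r x t : 0 <= t -> P x (p (x + t *: e) - t * p e) by exists t.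
have qp x : inf (P x) <= p x.
  by apply: qP; have := P'r x 0 (lexx _); rewrite scale0r addr0 mul0r subr0.
exists (fun x => inf (P x)); split=> //.
have h1 : inf (P (- e)) <= - p e.
  apply: qP; have := P'r (- e) 1 ler01.
  by rewrite scale1r addNr sublinear0// mul1r sub0r.
have h2 := qp e.
by have := sublinearN_ge q_sub e; lra.
Qed.

Lemma sublinear_linear (E : lmodType R) (p : E -> R) :
  sublinear p -> (forall x, p (- x) = - p x) -> scalar p.
Proof.
move=> p_sub pN.
have pD x y : p (x + y) = p x + p y.
  apply/eqP; rewrite eq_le p_sub.1/= -lerN2 opprD -!pN opprD p_sub.1//.
have pZ c x : p (c *: x) = c * p x.
  have [c0|c0|<-] := ltgtP 0 c; first exact: sublinearZ.
    by rewrite -[c]opprK scaleNr pN sublinearZ ?oppr_gt0 ?mulNr.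
  by rewrite scale0r mul0r sublinear0.
by move=> c x y; rewrite pD pZ.
Qed.

(** The function is lowered along the vectors of a basis in turn. Oddness at the earlier vectors
    survives each step, because a smaller sublinear function remains odd wherever the larger one is.
    Oddness on a basis spreads to all of E and makes the function linear. *)
Lemma hahn_banach (E : vectType R) (p : E -> R) :
  sublinear p -> exists f : {scalar E}, forall x, f x <= p x.
Proof.
move=> p_sub.
have /(_ (vbasis {:E}))[q [q_sub qp qN]] (s : seq E) : exists q : E -> R,
    [/\ sublinear q, forall x, q x <= p x & {in s, forall e, q (- e) = - q e}].
  elim: s => [|e s [q [q_sub qp qN]]]; first by exists p.
  have [q' [q'_sub q'q q'N]] := sublinear_linear_along e q_sub.
  exists q'; split=> // [x|x]; first exact: le_trans (q'q x) (qp x).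
  rewrite inE => /predU1P[->//|xs].
  have := q'q x; have := q'q (- x); have := sublinearN_ge q'_sub x.
  by rewrite qN//; lra.
have qD x y : q (- x) = - q x -> q (- y) = - q y -> q (- (x + y)) = - q (x + y).
  move=> xN yN; apply/eqP; rewrite eq_le sublinearN_ge// andbT.
  have := q_sub.1 x y; have := q_sub.1 (- x) (- y).
  by rewrite opprD xN yN; lra.
have qZ c x : q (- x) = - q x -> q (- (c *: x)) = - q (c *: x).
  move=> xN; have [c0|c0|<-] := ltgtP 0 c.
  - by rewrite -scalerN !(sublinearZ q_sub)// xN mulrN.
  - rewrite -scaleNr sublinearZ ?oppr_gt0// -[X in q (X *: _)]opprK scaleNr.
    by rewrite -scalerN sublinearZ ?oppr_gt0// xN mulrN opprK.
  - by rewrite scale0r oppr0 sublinear0// oppr0.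
have q_lin : scalar q.
  apply: sublinear_linear => // x; rewrite (coord_vbasis (memvf x)).
  elim/big_ind: _ => [||]; first by rewrite oppr0 sublinear0// oppr0.
    exact: qD.
  by move=> i _; apply/qZ/qN/mem_nth; rewrite size_tuple.
pose f : {scalar E} := HB.pack q (GRing.isLinear.Build _ _ _ _ q q_lin).
by exists f.
Qed.

End Sublinear.

(** * A pair of linear forms under four sublinear bounds *)

Section FourForms.
Variables (R : realType) (E : vectType R) (S : E -> R -> R -> Prop).
Variables (M1 M2 M3 M4 : E -> R) (al be ga de : R).
Hypothesis SZ : forall c v s t, S v s t -> S (c *: v) (c * s) (c * t).
Hypotheses (M1_sub : sublinear M1) (M2_sub : sublinear M2).
Hypotheses (M3_sub : sublinear M3) (M4_sub : sublinear M4).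
Hypothesis M1_ub : forall v s t, S v s t -> - (al * s + ga * t) <= M1 v.
Hypothesis M2_ub : forall v s t, S v s t -> s <= M2 v.
Hypothesis M3_ub : forall v s t, S v s t -> - (be * s + de * t) <= M3 v.
Hypothesis M4_ub : forall v s t, S v s t -> t <= M4 v.
Hypothesis M2_max : forall v, exists s t, S v s t /\ s = M2 v.
Hypothesis M4_max : forall v, exists s t, S v s t /\ t = M4 v.

(* Subadditivity bounds M2 and M4 at the combinations of y and z once a point
   of S z extremizes the first coordinate and a point of S y the second. *)
Lemma four_forms_ge0 y z :
  0 <= M1 y + M3 z + M2 (al *: y + be *: z) + M4 (ga *: y + de *: z).
Proof.
(* A maximizer over [- be *: z] is scaled back to a point over z; if [be = 0], any point over z will
   do. *)
have [s [t [Sz sE]]] : exists s t, S z s t /\ - be * s = M2 (- be *: z).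
  have [-> |be0] := eqVneq be 0.
    have [s [t [Sz _]]] := M2_max z; exists s, t; split=> //.
    by rewrite oppr0 mul0r scale0r sublinear0.
  have be0' : - be != 0 by rewrite oppr_eq0.
  have [s [t [Sz sE]]] := M2_max (- be *: z).
  exists ((- be)^-1 * s), ((- be)^-1 * t); split; last by rewrite mulVKf.
  by rewrite -[z](scalerK be0'); exact: SZ.
have [a [b [Sy bE]]] : exists a b, S y a b /\ - ga * b = M4 (- ga *: y).
  have [-> |ga0] := eqVneq ga 0.
    have [a [b [Sy _]]] := M4_max y; exists a, b; split=> //.
    by rewrite oppr0 mul0r scale0r sublinear0.
  have ga0' : - ga != 0 by rewrite oppr_eq0.
  have [a [b [Sy bE]]] := M4_max (- ga *: y).
  exists ((- ga)^-1 * a), ((- ga)^-1 * b); split; last by rewrite mulVKf.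
  by rewrite -[y](scalerK ga0'); exact: SZ.
(* Subadditivity gives [al * a + be * s] as a lower bound for the M2 term and [ga * b + de * t] for
   the M4 term. They cancel the lower bounds [- (al * a + ga * b)] of [M1 y] and
   [- (be * s + de * t)] of [M3 z]. *)
have := M1_ub Sy; have := M3_ub Sz.
have := M2_ub (SZ al Sy); have := M4_ub (SZ de Sz).
have := M2_sub.1 (al *: y + be *: z) (- be *: z).
rewrite scaleNr addrK -scaleNr -sE.
have := M4_sub.1 (ga *: y + de *: z) (- ga *: y).
rewrite scaleNr addrC addKr -scaleNr -bE.
lra.
Qed.

(** The pair is one linear form F on the product of two copies of E, bounded by M2 and M4 on the two
    factors, by M1 at the pairs [(- al *: v, - ga *: v)] and by M3 at the pairs
    [(- be *: v, - de *: v)]. The infimum of [P w] is the infimal convolution of these four bounds.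
    It is finite by [four_forms_ge0], and Hahn-Banach puts F below it. *)
Lemma four_forms : exists f g : {scalar E},
  [/\ forall v, - (al * f v + ga * g v) <= M1 v, forall v, f v <= M2 v,
      forall v, - (be * f v + de * g v) <= M3 v & forall v, g v <= M4 v].
Proof.
pose P (w : E * E) := [set r | exists y z, M1 y + M3 z +
  M2 (w.1 + (al *: y + be *: z)) + M4 (w.2 + (ga *: y + de *: z)) <= r].
have [||||p_sub pP] := @inf_sublinear R (E * E)%type P.
- by move=> w; eexists; exists 0, 0.
- move=> w w' r r' [y [z h]] [y' [z' h']]; exists (y + y'), (z + z').
  have D (a b : R) (u u' : E) : u + u' + (a *: (y + y') + b *: (z + z')) =
      u + (a *: y + b *: z) + (u' + (a *: y' + b *: z')).
    by rewrite !scalerDr (addrACA (a *: y)) (addrACA u).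
  rewrite /= !D.
  have := M1_sub.1 y y'; have := M3_sub.1 z z'.
  have := M2_sub.1 (w.1 + (al *: y + be *: z)) (w'.1 + (al *: y' + be *: z')).
  have := M4_sub.1 (w.2 + (ga *: y + de *: z)) (w'.2 + (ga *: y' + de *: z')).
  lra.
- move=> c w r c0 [y [z h]]; exists (c *: y), (c *: z).
  have D (a b : R) (u : E) : c *: u + (a *: (c *: y) + b *: (c *: z)) =
      c *: (u + (a *: y + b *: z)).
    by rewrite !scalerDr !scalerA ![_ * c]mulrC.
  rewrite /= !D (sublinearZ M1_sub)// (sublinearZ M2_sub)//.
  by rewrite (sublinearZ M3_sub)// (sublinearZ M4_sub)// -!mulrDr ler_pM2l.
- move=> r [y [z]]; rewrite /= !add0r; apply: le_trans.
  exact: four_forms_ge0.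
have [F Fp] := hahn_banach p_sub.
have FP w r : P w r -> F w <= r by move=> /pP; apply: le_trans.
have f_lin : scalar (fun v => F (v, 0)).
  move=> c u v; rewrite -linearP; congr (F _).
  by congr pair; rewrite /= scaler0 addr0.
have g_lin : scalar (fun v => F (0, v)).
  move=> c u v; rewrite -linearP; congr (F _).
  by congr pair; rewrite /= scaler0 addr0.
pose f : {scalar E} := HB.pack (fun v => F (v, 0))
  (GRing.isLinear.Build _ _ _ _ _ f_lin).
pose g : {scalar E} := HB.pack (fun v => F (0, v))
  (GRing.isLinear.Build _ _ _ _ _ g_lin).
have fgE a b v : a * f v + b * g v = F (a *: v, b *: v).
  rewrite -[a * _]linearZ -[b * _]linearZ /=.
  have -> : (a *: v, b *: v) = (a *: v, 0) + (0, b *: v) :> E * E.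
    by congr pair; rewrite /= ?addr0 ?add0r.
  by rewrite linearD.
have M0 := (sublinear0 M1_sub, sublinear0 M2_sub, sublinear0 M3_sub,
  sublinear0 M4_sub).
exists f, g; split=> v.
- rewrite fgE -linearN; apply: FP; exists v, 0.
  by rewrite /= !scaler0 !addr0 !addNr !M0 !addr0.
- apply: FP; exists 0, 0; rewrite /= !scaler0 !addr0 !M0.
  by rewrite !add0r addr0.
- rewrite fgE -linearN; apply: FP; exists 0, v.
  by rewrite /= !scaler0 !add0r !addNr !M0 !addr0 add0r.
- apply: FP; exists 0, 0; rewrite /= !scaler0 !addr0 !M0.
  by rewrite !add0r.
Qed.

End FourForms.

(** * Planar convex sets and chains of edges *)

Section Octagon.
Variable R : realType.

Definition convex2 (P : R -> R -> Prop) : Prop :=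
  forall a b a' b' t, 0 <= t <= 1 -> P a b -> P a' b' ->
    P (t * a + (1 - t) * a') (t * b + (1 - t) * b').

(** The chord between the two points crosses height b, and both its ends lie to the left of the line
    through (a, b) with inverse slope d. Using the inverse slope allows vertical edges, as
    [d = 0]. *)
Lemma convex2_left_of_edge (P : R -> R -> Prop) (d a b x y x' y' : R) :
  convex2 P -> P x y -> P x' y' -> y' <= b <= y ->
  x - d * y <= a - d * b -> x' - d * y' <= a - d * b ->
  exists2 a', a' <= a & P a' b.
Proof.
move=> cP Pxy Pxy' /andP[y'b yb] h h'.
have [yy'|yy'] := leP y y'.
  have E1 : y' = b by lra.
  by exists x'; [subst b; lra|rewrite -E1].
pose t := (b - y') / (y - y').
have d0 : y - y' != 0 by rewrite subr_eq0 gt_eqF.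
have tE : t * y + (1 - t) * y' = b by rewrite /t; field.
have t01 : 0 <= t <= 1.
  by rewrite divr_ge0 ?ler_pdivrMr ?subr_gt0 ?subr_ge0 ?(ltW yy')//; lra.
exists (t * x + (1 - t) * x'); last by rewrite -tE; exact: cP.
have /andP[t0 t1] := t01.
have : t * (x - d * y) <= t * (a - d * b) by rewrite ler_wpM2l.
have : (1 - t) * (x' - d * y') <= (1 - t) * (a - d * b).
  by rewrite ler_wpM2l// subr_ge0.
have : d * (t * y + (1 - t) * y') = d * b by rewrite tE.
lra.
Qed.

(* [(a, b)] lies to the right of the chain p1 p2 p3 p4, whose edges have slopes
   [1], [oo] and [- mu]. *)
Lemma convex2_left_of_chain (P : R -> R -> Prop) (mu a b x1 y1 x2 y2 x3 y3 x4 y4 : R) :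
  0 < mu -> convex2 P -> P x1 y1 -> P x2 y2 -> P x3 y3 -> P x4 y4 ->
  b <= y1 -> b - a <= y1 - x1 -> b - a <= y2 - x2 -> x2 <= a ->
  x3 <= a -> mu * x3 + y3 <= mu * a + b -> mu * x4 + y4 <= mu * a + b ->
  y4 <= b -> exists2 a', a' <= a & P a' b.
Proof.
move=> mu0 cP P1 P2 P3 P4 by1 h1 h2 x2a x3a h3 h4 y4b.
(* The chain starts at height at least b and ends at height at most b, so one of its three edges
   crosses that height; their inverse slopes are [1], [0] and [- mu^-1]. *)
have [y2b|y2b] := leP y2 b.
  by apply: (convex2_left_of_edge (d := 1) cP P1 P2); lra.
have [y3b|y3b] := leP y3 b.
  by apply: (convex2_left_of_edge (d := 0) cP P2 P3); lra.
have E x y : mu * x + y <= mu * a + b -> x - (- mu^-1) * y <= a - (- mu^-1) * b.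
  rewrite !mulNr !opprK -[in X in X -> _](ler_pM2l (_ : 0 < mu^-1)) ?invr_gt0//.
  by rewrite !mulrDr !mulKf ?gt_eqF.
by apply: (convex2_left_of_edge (d := - mu^-1) cP P3 P4); [lra|exact: E..].
Qed.

Lemma convex2_between (P : R -> R -> Prop) (a b a' a'' : R) :
  convex2 P -> P a' b -> P a'' b -> a' <= a <= a'' -> P a b.
Proof.
move=> cP P' P'' /andP[h' h''].
have [e|ne] := leP a'' a'; first by have -> : a = a' by lra.
pose t := (a'' - a) / (a'' - a').
have d0 : a'' - a' != 0 by rewrite subr_eq0 gt_eqF.
have t01 : 0 <= t <= 1.
  by rewrite divr_ge0 ?ler_pdivrMr ?subr_gt0 ?subr_ge0 ?(ltW ne)//; lra.
have := cP _ _ _ _ _ t01 P' P''.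
have -> : t * a' + (1 - t) * a'' = a by rewrite /t; field.
by have -> : t * b + (1 - t) * b = b by ring.
Qed.

End Octagon.

(** * Fibers over the cosets of L and their support functions *)

Lemma scalar_comb (R : realType) (V : lmodType R) (f : {scalar V}) a b u w :
  f (a *: u + b *: w) = a * f u + b * f w.
Proof. by rewrite linearD [f (a *: u)]linearZ [f (b *: w)]linearZ. Qed.

Section Fibers.
Variables (R : realType) (V : vectType R) (L : {vspace V}) (Z : set V).

(** The section of Z by the coset [v + L]. It depends only on v modulo L, so no complement of L has
    to be chosen. *)
Definition fiber (v : V) : set V := [set z | Z z /\ z - v \in L].

Definition fiber_max (phi : {scalar V}) (M : V -> R) : Prop :=
  forall v, (exists2 z, fiber v z & phi z = M v) /\
            (forall z, fiber v z -> phi z <= M v).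

Lemma fiber_mod v w : v - w \in L -> fiber v `<=` fiber w.
Proof.
by move=> vwL z [Zz zv]; split=> //; rewrite -[z](subrK v) -addrA memvD.
Qed.

Hypothesis ZZ : forall c z, Z z -> Z (c *: z).

Lemma fiberZ c v z : fiber v z -> fiber (c *: v) (c *: z).
Proof. by case=> Zz zv; split; [exact: ZZ|rewrite -scalerBr memvZ]. Qed.

Lemma fiber_max_mod phi M v w : fiber_max phi M -> v - w \in L -> M v = M w.
Proof.
move=> MP vwL; have [[z vz zE] ubv] := MP v; have [[z' wz' z'E] ubw] := MP w.
apply/eqP; rewrite eq_le -[X in X <= _]zE ubw; last exact: fiber_mod vz.
by rewrite -z'E ubv//; apply: fiber_mod wz'; rewrite -opprB memvN.
Qed.

Lemma fiber_max_le phi M c v : fiber_max phi M -> 0 < c -> M (c *: v) <= c * M v.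
Proof.
move=> MP c0; have [[z cvz <-] _] := MP (c *: v).
rewrite -ler_pdivrMl// -linearZ/=; apply: (MP v).2.
by rewrite -[v](scalerK (lt0r_neq0 c0)); exact: fiberZ.
Qed.

Lemma fiber_maxZ phi M c v : fiber_max phi M -> 0 < c -> M (c *: v) = c * M v.
Proof.
move=> MP c0; apply/eqP; rewrite eq_le (fiber_max_le _ MP)//= -ler_pdivlMl//.
by rewrite -{1}[v](scalerK (lt0r_neq0 c0)) (fiber_max_le _ MP) ?invr_gt0//.
Qed.

Hypothesis fiber_convex : forall v z z' t,
  0 <= t <= 1 -> fiber v z -> fiber v z' -> fiber v (t *: z + (1 - t) *: z').

(* [hits v] says that the projection of v from the center T = ker phi in L
   belongs to the projection of Z. *)
Definition hits (phi : V -> R) (v : V) : Prop :=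
  exists2 z, fiber v z & phi z = phi v.

Section Concave.
Variables (phi h : {scalar V}) (e : V) (M : V -> R).
Hypotheses (eL : e \in L) (phi_e : phi e = 1).
Hypothesis hL : forall u, u \in L -> h u = phi u.
Hypothesis h0 : forall v, h v = 0 -> hits phi v.
Hypothesis h1 : forall v w t, 0 <= t <= 1 -> h v = 1 -> h w = 1 ->
  ~ hits phi v -> ~ hits phi w -> ~ hits phi (t *: v + (1 - t) *: w).
Hypothesis MP : fiber_max phi M.

(** This form vanishes on L. Its value at v is the value of [phi] at every point of the coset
    [v + L] lying in the hyperplane [h = 0]. *)
Let k v := phi v - h v.

Let k_le v : k v <= M v.
Proof.
have [|z vz zE] := h0 (v := v - h v *: e).
  by rewrite linearB linearZ/= (hL eL) phi_e mulr1 subrr.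
have -> : k v = phi z.
  by rewrite zE linearB linearZ/= phi_e mulr1.
apply: (MP v).2; apply: fiber_mod vz.
by rewrite addrAC subrr add0r memvN memvZ.
Qed.

(** On the fiber, [phi] attains its maximum [M v]. It also attains [phi v - 1], since [v - e] lies
    in the kernel of [h] and so is hit. Convexity of the fiber supplies every value in between. *)
Let hitsE v : h v = 1 -> (phi v <= M v) <-> hits phi v.
Proof.
move=> hv; split=> [le|[z vz <-]]; last exact: (MP v).2.
have [[z2 vz2 z2E] _] := MP v.
have [|z1 vz1 z1E] := h0 (v := v - e).
  by rewrite linearB/= hv (hL eL) phi_e subrr.
have vz1' : fiber v z1.
  by apply: fiber_mod vz1; rewrite addrAC subrr add0r memvN.
have z1E' : phi z1 = phi v - 1 by rewrite z1E linearB/= phi_e.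
pose t := (phi v - phi z1) / (M v - phi z1).
have d : 0 < M v - phi z1 by lra.
have t01 : 0 <= t <= 1.
  by rewrite divr_ge0 ?ler_pdivrMr//; lra.
have tE : t * (M v - phi z1) = phi v - phi z1.
  by rewrite divfK// lt0r_neq0.
clearbody t; exists (t *: z2 + (1 - t) *: z1); first exact: fiber_convex.
by rewrite scalar_comb z2E; lra.
Qed.

(** On the level [h = 1], where [phi = k + 1], the points that are not hit are those with
    [M - k < 1]. So [M - k] is a nonnegative, positively homogeneous function with a convex open
    unit ball, that is, a gauge. It is subadditive, and [k] is linear. *)
Lemma fiber_max_sublinear : sublinear M.
Proof.
split=> [x y|c x c0]; last exact: fiber_max_le.
apply/ler_addgt0Pr => eps eps0.
(* The margin [eps / 2] makes [g] positive and larger than the gauge, so v divided by [g v] lies in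
   the open unit ball. The vector [sh v] is this quotient moved along [e] to the level [h = 1]. *)
pose g v := M v - k v + eps / 2.
have g_gt0 v : 0 < g v by rewrite /g; have := k_le v; lra.
pose sh v := (g v)^-1 *: v + (1 - (g v)^-1 * h v) *: e.
have h_sh v : h (sh v) = 1.
  by rewrite scalar_comb (hL eL) phi_e; ring.
have gi v : 0 < (g v)^-1 by rewrite invr_gt0.
have miss v : ~ hits phi (sh v).
  rewrite -hitsE//; apply/negP; rewrite -ltNge.
  have -> : M (sh v) = (g v)^-1 * M v.
    rewrite -(fiber_maxZ _ MP)//; apply: (fiber_max_mod MP).
    by rewrite addrAC subrr add0r memvZ.
  rewrite scalar_comb phi_e mulr1 -subr_gt0.
  have -> : (g v)^-1 * phi v + (1 - (g v)^-1 * h v) - (g v)^-1 * M v =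
      (g v)^-1 * (eps / 2).
    have := lt0r_neq0 (g_gt0 v).
    have -> : M v = g v - eps / 2 + phi v - h v by rewrite /g /k; lra.
    by move=> gv0; field.
  by rewrite mulr_gt0// divr_gt0.
pose s := g x + g y.
have s0 : 0 < s by rewrite addr_gt0.
(* With these weights the combination of [sh x] and [sh y] is [s^-1 *: (x + y)] modulo [e]. *)
pose t := g x / s.
have tE : 1 - t = g y / s by rewrite /t /s; field; exact: lt0r_neq0.
have t01 : 0 <= t <= 1.
  by rewrite -[t <= 1]subr_ge0 tE !divr_ge0// ltW.
pose w := t *: sh x + (1 - t) *: sh y.
have hw : h w = 1 by rewrite scalar_comb !h_sh; ring.
have := h1 t01 (h_sh x) (h_sh y) (miss x) (miss y).
rewrite -/w -hitsE// => /negP; rewrite -ltNge.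
have wE : w = s^-1 *: (x + y) +
    (t * (1 - (g x)^-1 * h x) + (1 - t) * (1 - (g y)^-1 * h y)) *: e.
  rewrite /w /sh !scalerDr !scalerA tE addrACA -scalerDl /t.
  congr (_ *: _ + _ *: _ + _).
  - by field; rewrite !lt0r_neq0.
  - by field; rewrite !lt0r_neq0.
have -> : M w = s^-1 * M (x + y).
  rewrite -(fiber_maxZ _ MP) ?invr_gt0//; apply: (fiber_max_mod MP).
  by rewrite wE addrAC subrr add0r memvZ.
have -> : phi w = k w + 1 by rewrite /k hw; ring.
have -> : k w = s^-1 * k (x + y).
  by rewrite /k wE !scalar_comb (hL eL) !linearD/=; ring.
rewrite ltr_pdivrMl// mulrDr mulrA divff ?lt0r_neq0// mul1r mulr1 => lt.
have : k (x + y) = k x + k y by rewrite /k !linearD/=; ring.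
move: lt; rewrite /s /g; lra.
Qed.

End Concave.
End Fibers.

(** * A linear selection from fibers with four pairs of corners *)

Section LinearCombination.
Variables (R : realType) (V : lmodType R) (f g : {scalar V}) (a b : R).

Definition lincomb (v : V) : R := a * f v + b * g v.

Fact lincomb_is_scalar : scalar lincomb.
Proof. by move=> c u v; rewrite /lincomb !linearP; ring. Qed.

HB.instance Definition _ :=
  GRing.isLinear.Build R V R _ lincomb lincomb_is_scalar.

End LinearCombination.

Section Selection.
Variables (R : realType) (V : vectType R) (L : {vspace V}) (Z : set V).

(* A fiber pointed with respect to the segment [phi * psi >= 0] of L. *)
Definition corners (phi psi : {scalar V}) : Prop := forall v, exists z1 z2,
  [/\ fiber L Z v z1, fiber L Z v z2 &
      forall z, fiber L Z v z ->
        phi z1 <= phi z <= phi z2 /\ psi z1 <= psi z <= psi z2].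

Lemma corners_max (phi psi : {scalar V}) :
  corners phi psi -> exists M, fiber_max L Z phi M.
Proof.
move=> c; have /choice[F FP] : forall v, exists z, fiber L Z v z /\
    forall z', fiber L Z v z' -> phi z' <= phi z.
  move=> v; have [z1 [z [_ vz zP]]] := c v; exists z; split=> // z'.
  by move/zP => [/andP[]].
exists (phi \o F) => v; have [vz zP] := FP v.
by split=> //; exists (F v).
Qed.

Hypothesis ZZ : forall c z, Z z -> Z (c *: z).

Lemma fiber_max_ub (phi f : {scalar V}) M v z :
  fiber_max L Z phi M -> (forall v, f v <= M v) ->
  (forall z', fiber L Z v z' -> phi z' <= phi z) -> f v <= phi z.
Proof.
move=> MP fM zP; have [[z' vz' z'E] _] := MP v.
by rewrite (le_trans (fM v))// -z'E zP.
Qed.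

(** Since Z is symmetric, a minimum over the fiber of v is minus a maximum over the fiber of [- v];
    hence upper bounds for a linear form also bound it from below. *)
Lemma fiber_max_lb (phi f : {scalar V}) M v z :
  fiber_max L Z phi M -> (forall v, f v <= M v) ->
  (forall z', fiber L Z v z' -> phi z <= phi z') -> phi z <= f v.
Proof.
move=> MP fM zP; rewrite -lerN2 -!linearN.
apply: (fiber_max_ub MP fM) => z' vz'; rewrite linearN lerNr -linearN.
by apply: zP; have := fiberZ ZZ (-1) vz'; rewrite !scaleN1r opprK.
Qed.

Hypothesis fiber_convex : forall v z z' t, 0 <= t <= 1 ->
  fiber L Z v z -> fiber L Z v z' -> fiber L Z v (t *: z + (1 - t) *: z').

Variables (x y : {scalar V}) (e1 e2 : V) (mu : R).
Hypothesis mu0 : 0 < mu.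
Hypothesis L_coord : forall u, u \in L -> u = x u *: e1 + y u *: e2.

(** In the application [y], [D], [x] and [E] vanish on [e1], [e1 + e2], [e2] and [e1 - mu *: e2],
    which span a_1, a_2, a_3 and a_4. The form [D'] is [- D], with the sign that fits the segment
    I_2. *)
Let D : {scalar V} := lincomb y x 1 (- 1).
Let D' : {scalar V} := lincomb x y 1 (- 1).
Let E : {scalar V} := lincomb x y mu 1.

Hypotheses (c1 : corners y D) (c2 : corners x D').
Hypotheses (c3 : corners x E) (c4 : corners y E).
Hypothesis x_sub : forall M, fiber_max L Z x M -> sublinear M.
Hypothesis y_sub : forall M, fiber_max L Z y M -> sublinear M.
Hypothesis D_sub : forall M, fiber_max L Z D M -> sublinear M.
Hypothesis E_sub : forall M, fiber_max L Z E M -> sublinear M.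

(** In the coordinates [x] and [y], each fiber is a planar convex set with extremal points supplied
    by the four pairs of corners. The forms from [four_forms] respect the four upper bounds, hence
    by symmetry also the four lower ones, and this places [(f v, g v)] between a left and a right
    chain of corners. *)
Lemma linear_selection : exists f g : {scalar V},
  forall v, Z (v + ((f v - x v) *: e1 + (g v - y v) *: e2)).
Proof.
pose P v s t := exists2 z, fiber L Z v z & x z = s /\ y z = t.
have cD : corners D y.
  move=> v; have [z1 [z2 [h1 h2 h]]] := c1 v.
  by exists z1, z2; split=> // z /h[].
have cE : corners E y.
  move=> v; have [z1 [z2 [h1 h2 h]]] := c4 v.
  by exists z1, z2; split=> // z /h[].
have [Mx MxP] := corners_max c2; have [My MyP] := corners_max c1.
have [MD MDP] := corners_max cD; have [ME MEP] := corners_max cE.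
(* The coefficients are chosen so that [- (al * s + ga * t)] is [D] and [- (be * s + de * t)] is
   [E]. *)
have [f [g [fgD fx fgE gy]]] : exists f g : {scalar V},
  [/\ forall v, - (1 * f v + (- 1) * g v) <= MD v, forall v, f v <= Mx v,
      forall v, - (- mu * f v + (- 1) * g v) <= ME v & forall v, g v <= My v].
  apply: (@four_forms R V P).
  - move=> c v s t [z vz [<- <-]]; exists (c *: z); first exact: fiberZ.
    by split; exact: linearZ.
  - exact: D_sub.
  - exact: x_sub.
  - exact: E_sub.
  - exact: y_sub.
  - move=> v s t [z vz [<- <-]]; have := (MDP v).2 z vz.
    by rewrite /= /lincomb; lra.
  - by move=> v s t [z vz [<- _]]; exact: (MxP v).2.
  - move=> v s t [z vz [<- <-]]; have := (MEP v).2 z vz.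
    by rewrite /= /lincomb; lra.
  - by move=> v s t [z vz [_ <-]]; exact: (MyP v).2.
  - move=> v; have [[z vz zE] _] := MxP v; exists (x z), (y z).
    by split=> //; exists z.
  - move=> v; have [[z vz zE] _] := MyP v; exists (x z), (y z).
    by split=> //; exists z.
pose fD : {scalar V} := lincomb g f 1 (- 1).
pose fE : {scalar V} := lincomb f g mu 1.
have fDM v : fD v <= MD v.
  by apply: le_trans (fgD v); rewrite /= /lincomb; lra.
have fEM v : fE v <= ME v.
  by apply: le_trans (fgE v); rewrite /= /lincomb; lra.
exists f, g => v.
have cP : convex2 (P v).
  move=> a b a' b' t t01 [z vz [<- <-]] [z' vz' [<- <-]].
  exists (t *: z + (1 - t) *: z'); first exact: fiber_convex.
  by rewrite !scalar_comb.
suff [z [Zz zv] [<- <-]] : P v (f v) (g v).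
  have -> : v + ((x z - x v) *: e1 + (y z - y v) *: e2) = z => //.
  by rewrite -(linearB x) -(linearB y) -L_coord// addrC subrK.
(* The points [p1] to [p4] form the left chain, from top to bottom: [p1] maximizes [y] and [D], [p2]
   minimizes [x] and maximizes [D], [p3] minimizes [x] and [E], [p4] minimizes [y] and [E]. The
   points [q1] to [q4] are the opposite corners and form the right chain. *)
have [q1 [p1 [vq1 vp1 h1]]] := c1 v.
have [p2 [q2 [vp2 vq2 h2]]] := c2 v.
have [p3 [q3 [vp3 vq3 h3]]] := c3 v.
have [p4 [q4 [vp4 vq4 h4]]] := c4 v.
have ub (phi ff : {scalar V}) M z : fiber_max L Z phi M ->
    (forall v, ff v <= M v) ->
    (forall z', fiber L Z v z' -> phi z' <= phi z) -> ff v <= phi z.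
  exact: fiber_max_ub.
have lb (phi ff : {scalar V}) M z : fiber_max L Z phi M ->
    (forall v, ff v <= M v) ->
    (forall z', fiber L Z v z' -> phi z <= phi z') -> phi z <= ff v.
  exact: fiber_max_lb.
have PP z : fiber L Z v z -> P v (x z) (y z) by exists z.
have [a' a'f Pa'] : exists2 a', a' <= f v & P v a' (g v).
  apply: (convex2_left_of_chain mu0 cP (PP _ vp1) (PP _ vp2) (PP _ vp3)
    (PP _ vp4)).
  - by apply: ub MyP gy _ => z /h1[/andP[]].
  - have := ub _ _ _ p1 MDP fDM; rewrite /= /lincomb !mul1r !mulN1r; apply.
    by move=> z /h1[_ /andP[_]]; rewrite /= /lincomb; lra.
  - have := ub _ _ _ p2 MDP fDM; rewrite /= /lincomb !mul1r !mulN1r; apply.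
    by move=> z /h2[_ /andP[+ _]]; rewrite /= /lincomb; lra.
  - by apply: lb MxP fx _ => z /h2[/andP[]].
  - by apply: lb MxP fx _ => z /h3[/andP[]].
  - have := lb _ _ _ p3 MEP fEM; rewrite /= /lincomb !mul1r; apply.
    by move=> z /h3[_ /andP[+ _]]; rewrite /= /lincomb; lra.
  - have := lb _ _ _ p4 MEP fEM; rewrite /= /lincomb !mul1r; apply.
    by move=> z /h4[_ /andP[+ _]]; rewrite /= /lincomb; lra.
  - by apply: lb MyP gy _ => z /h4[/andP[]].
(* A central reflection turns the right chain into a left one. *)
pose P' s t := P v (- s) (- t).
have cP' : convex2 P'.
  move=> a b c d t t01 Pab Pcd; rewrite /P'.
  have := cP _ _ _ _ _ t01 Pab Pcd.
  by rewrite !mulrN !opprD.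
have PP' z : fiber L Z v z -> P' (- x z) (- y z).
  by move=> vz; rewrite /P' !opprK; exact: PP.
have [a'' a''f Pa''] : exists2 a'', a'' <= - f v & P' a'' (- g v).
  apply: (convex2_left_of_chain mu0 cP' (PP' _ vq1) (PP' _ vq2) (PP' _ vq3)
    (PP' _ vq4)).
  - by rewrite lerN2; apply: lb MyP gy _ => z /h1[/andP[]].
  - suff : D q1 <= fD v by rewrite /= /lincomb; lra.
    by apply: lb MDP fDM _ => z /h1[_ /andP[]].
  - suff : D q2 <= fD v by rewrite /= /lincomb; lra.
    apply: lb MDP fDM _ => z /h2[_ /andP[_]]; rewrite /= /lincomb; lra.
  - by rewrite lerN2; apply: ub MxP fx _ => z /h2[/andP[]].
  - by rewrite lerN2; apply: ub MxP fx _ => z /h3[/andP[]].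
  - suff : fE v <= E q3 by rewrite /= /lincomb; lra.
    by apply: ub MEP fEM _ => z /h3[_ /andP[]].
  - suff : fE v <= E q4 by rewrite /= /lincomb; lra.
    by apply: ub MEP fEM _ => z /h4[_ /andP[]].
  - by rewrite lerN2; apply: ub MyP gy _ => z /h4[/andP[]].
apply: (convex2_between (a' := a') (a'' := - a'') cP) => //.
  by move: Pa''; rewrite /P' opprK.
by rewrite a'f lerNr.
Qed.

End Selection.

(** * Linear algebra of hyperplanes and convex combinations *)

Lemma dual_form (R : realType) (V : vectType R) (U : {vspace V}) (e : V) :
  e \notin U -> exists h : {scalar V}, h e = 1 /\ forall u, u \in U -> h u = 0.
Proof.
move=> eU.
have d0 : e - projv U e != 0.
  by apply: contraNneq eU => /subr0_eq ->; exact: memv_proj.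
(* The coordinates of [v - projv U v] are linear forms in v that vanish on U, and one of them is
   nonzero at e. *)
have [i ci0] : exists i, coord (vbasis {:V}) i (e - projv U e) != 0.
  apply: contrapT => all0; case/eqP: d0.
  rewrite (coord_vbasis (memvf (e - _))) big1// => i _.
  have [->|ne] := eqVneq (coord (vbasis {:V}) i (e - projv U e)) 0.
    by rewrite scale0r.
  by case: all0; exists i.
set c := coord _ _ _ in ci0.
have h_lin : scalar (fun v => c^-1 * coord (vbasis {:V}) i (v - projv U v)).
  move=> a u v.
  have -> : a *: u + v - projv U (a *: u + v) =
      a *: (u - projv U u) + (v - projv U v).
    by rewrite linearP opprD addrACA scalerBr.
  by rewrite linearP/= mulrDr mulrCA.
pose h : {scalar V} := HB.pack
  (fun v => c^-1 * coord (vbasis {:V}) i (v - projv U v))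
  (GRing.isLinear.Build _ _ _ _ _ h_lin).
exists h; split=> [|u uU]; first exact: mulVf.
by rewrite /h/= projv_id// subrr linear0 mulr0.
Qed.

Lemma hyperplane_decomp (R : realType) (V : vectType R) (H N : {vspace V})
    (h : {scalar V}) (e w : V) :
  (H <= N)%VS -> (\dim H).+1 = \dim N -> (forall u, u \in H -> h u = 0) ->
  e \in N -> h e = 1 -> w \in N -> w - h w *: e \in H.
Proof.
move=> HN dH hH eN he wN.
have eH : e \notin H by apply/negP => /hH/eqP; rewrite he oner_eq0.
have NE : (H + <[e]>)%VS = N.
  apply/eqP; rewrite eqEdim subv_add HN -memvE eN/= -dH dimv_disjoint_sum.
    by rewrite dim_vline; case: eqP eH => [->|_ _]; rewrite ?mem0v ?addn1.
  apply/eqP; rewrite -subv0; apply/subvP => z; rewrite memv_cap memv0.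
  case/andP=> zH /vlineP[k zE]; have : h z = 0 by exact: hH.
  by rewrite zE linearZ/= he mulr1 => ->; rewrite scale0r.
move: wN; rewrite -NE => /memv_addP[u uH [_ /vlineP[k ->] ->]].
by rewrite [h (_ + _)]linearD [h (_ *: _)]linearZ/= he mulr1 hH// add0r addrK.
Qed.

Lemma convex_setP (R : realType) (V : lmodType R)
    (S : set (convex_lmodType V)) (a b : V) (t : R) :
  convex_set S -> 0 <= t <= 1 -> S a -> S b -> S (t *: a + (1 - t) *: b).
Proof.
move=> cS /andP[t0 t1] Sa Sb.
by have := cS a b (Itv01 t0 t1) (mem_set Sa) (mem_set Sb); rewrite inE.
Qed.

Lemma vline_scale (F : fieldType) (V : vectType F) (r : F) (u : V) :
  r != 0 -> (<[u]> = <[r *: u]>)%VS.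
Proof.
move=> r0; apply/eqP; rewrite eqEsubv -!memvE memvZ ?memv_line// andbT.
by rewrite -[X in X \in _](scalerK r0) memvZ ?memv_line.
Qed.

(** * From projective sets to cones, fibers and support functions *)

Section ProjectiveSets.
Variables (R : realType) (n : nat).
Local Notation V := 'rV[R]_n.+1.
Implicit Types (T L N H : {vspace V}) (A : set (RP R n)).

Lemma quotprojE T (q : quotproj T) (w : V) :
  w \in val q -> w \notin T -> val q = (T + <[w]>)%VS.
Proof.
case: q => W /= /andP[TW /eqP dW] wW wT; apply/eqP.
by rewrite eq_sym eqEdim subv_add TW -memvE wW /= dW dimv_add_line.
Qed.

Lemma RP_vline (p : RP R n) (w : V) : w \in val p -> w != 0 -> val p = <[w]>%VS.
Proof. by move=> wp w0; rewrite (quotprojE wp) ?memv0// add0v. Qed.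

Lemma RP_nonzero (p : RP R n) : exists2 w : V, w \in val p & w != 0.
Proof.
exists (vpick (val p)); first exact: memv_pick.
by rewrite vpick0 -dimv_eq0; case: p => W /= /andP[_ /eqP->].
Qed.

Lemma vectorsZ T (S : set (quotproj T)) c (v : V) :
  vectors S v -> vectors S (c *: v).
Proof. by case=> q Sq qv; exists q => //=; exact: memvZ. Qed.

(** Zero is added explicitly because [vectors A] contains it only when A is nonempty. *)
Definition cone A : set V := [set v | v = 0 \/ vectors A v].

Lemma coneZ A c (v : V) : cone A v -> cone A (c *: v).
Proof.
by case=> [->|Av]; [left; rewrite scaler0|right; exact: vectorsZ].
Qed.

Lemma cone_vectors A (v : V) : cone A v -> v != 0 -> vectors A v.
Proof. by case=> [->|//]; rewrite eqxx. Qed.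

Lemma vectors_section A N (v : V) :
  v != 0 -> v \in N -> vectors A v -> vectors (A `&` points N) v.
Proof.
move=> v0 vN [p Ap vp]; exists p => //; split=> //.
by rewrite /points/= (RP_vline vp v0) -memvE.
Qed.

Lemma cone_disjoint A L (v : V) :
  A `&` points L = set0 -> cone A v -> v \in L -> v = 0.
Proof.
move=> AL0 Av vL; apply/eqP; apply: contraT => v0.
have [p Sp _] := vectors_section v0 vL (cone_vectors Av v0).
by have : (A `&` points L) p by []; rewrite AL0.
Qed.

(** The chart describes S on the affine hyperplane [o + H], the level [h o] of h. Scaling by [h o],
    which preserves [vectors S], carries the level 1 to it. *)
Lemma chart_convex_level T N H (S : set (quotproj T)) (o v w : V)
    (h : {scalar V}) (t : R) :
  (H <= N)%VS -> (\dim H).+1 = \dim N -> (forall u, u \in H -> h u = 0) ->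
  o \in N -> o \notin H ->
  convex_set (chart H o S : set (convex_lmodType V)) ->
  v \in N -> w \in N -> h v = 1 -> h w = 1 -> 0 <= t <= 1 ->
  vectors S v -> vectors S w -> vectors S (t *: v + (1 - t) *: w).
Proof.
move=> HN dH hH oN oH cS vN wN hv hw t01 Sv Sw.
have ho : h o != 0.
  apply: contraNneq oH => ho0.
  by have := hyperplane_decomp HN dH hH vN hv oN; rewrite ho0 scale0r subr0.
have inH z : z \in N -> h z = 1 -> h o *: z - o \in H.
  move=> zN hz; rewrite -opprB memvN.
  exact: hyperplane_decomp HN dH hH zN hz oN.
have inC z : z \in N -> h z = 1 -> vectors S z -> chart H o S (h o *: z - o).
  by move=> zN hz Sz; split; [exact: inH|rewrite addrC subrK; exact: vectorsZ].
have [_] := convex_setP cS t01 (inC v vN hv Sv) (inC w wN hw Sw).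
have -> : o + (t *: (h o *: v - o) + (1 - t) *: (h o *: w - o)) =
    h o *: (t *: v + (1 - t) *: w) by apply/rowP => i; rewrite !mxE; ring.
by move=> /(vectorsZ (h o)^-1); rewrite scalerK.
Qed.

(** The section is convex with H at infinity, whereas the fiber sits in a coset of L, with L at
    infinity. The segment from z to z' in the first chart stays in A, so it misses L; it is
    therefore the same projective segment as the one in the coset. *)
Lemma L_convex_fiber A L N (v z z' : V) (t : R) :
  A `&` points L = set0 -> (L <= N)%VS -> v \in N ->
  proj_convex N (A `&` points N) -> 0 <= t <= 1 ->
  fiber L (cone A) v z -> fiber L (cone A) v z' ->
  fiber L (cone A) v (t *: z + (1 - t) *: z').
Proof.
move=> AL0 LN vN [_ _ [H [LHN dH AH0 [ o [oN oH cS]]]]] t01.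
have HN : (H <= N)%VS by case/andP: LHN.
move=> [Az zv] [Az' zv'].
have zvL : t *: z + (1 - t) *: z' - v \in L.
  have -> : t *: z + (1 - t) *: z' - v = t *: (z - v) + (1 - t) *: (z' - v).
    by apply/rowP => i; rewrite !mxE; ring.
  by rewrite memvD// memvZ.
split=> //.
have zz'L : z - z' \in L.
  by rewrite -[z](subrK v) -addrA memvD// -opprB memvN.
have [z0|z0] := eqVneq z 0.
  have -> : z' = 0.
    apply: cone_disjoint AL0 Az' _.
    by move: zz'L; rewrite z0 sub0r memvN.
  by left; rewrite z0 !scaler0 addr0.
have [z'0|z'0] := eqVneq z' 0.
  by case/eqP: z0; apply: cone_disjoint AL0 Az _; rewrite -[z]subr0 -z'0.
have mN u : u - v \in L -> u \in N.
  by move=> /(subvP LN) uvN; rewrite -[u](subrK v) memvD.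
have [h [ho hH]] := dual_form oH.
have S_z := vectors_section z0 (mN _ zv) (cone_vectors Az z0).
have S_z' := vectors_section z'0 (mN _ zv') (cone_vectors Az' z'0).
have h_neq0 u : u != 0 -> u \in N -> vectors (A `&` points N) u -> h u != 0.
  move=> u0 uN [p Sp up]; apply/eqP => hu.
  have : (A `&` points N `&` points H) p.
    split=> //; rewrite /points/= (RP_vline up u0) -memvE.
    have := hyperplane_decomp HN dH hH oN ho uN.
    by rewrite hu scale0r subr0.
  by rewrite AH0.
have hz := h_neq0 z z0 (mN _ zv) S_z.
have hz' := h_neq0 z' z'0 (mN _ zv') S_z'.
have key s : 0 <= s <= 1 -> vectors (A `&` points N)
    (s *: ((h z)^-1 *: z) + (1 - s) *: ((h z')^-1 *: z')).
  move=> s01; apply: (chart_convex_level HN dH hH oN oH cS) => //.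
  - by rewrite memvZ// mN.
  - by rewrite memvZ// mN.
  - by rewrite linearZ/= mulVf.
  - by rewrite linearZ/= mulVf.
  - exact: vectorsZ.
  - exact: vectorsZ.
(* A sign change of h between z and z' would put on L, at the direction z - z',
   a point of the section. *)
have same_sign : 0 < h z * h z'.
  rewrite lt_neqAle eq_sym mulf_neq0//= leNgt; apply/negP => lt0.
  have d0 : h z - h z' != 0.
    by apply: contraTneq lt0 => /subr0_eq ->; rewrite -leNgt -expr2 sqr_ge0.
  have s01 : 0 <= h z / (h z - h z') <= 1.
    have [h'0|h'0|e0] := ltgtP 0 (h z').
    - have hz_lt0 : h z < 0 by rewrite -(pmulr_llt0 _ h'0).
      rewrite -mulrNN -invrN opprB divr_ge0 ?ler_pdivrMr; lra.
    - have hz_gt0 : 0 < h z by rewrite -(nmulr_llt0 _ h'0).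
      rewrite divr_ge0 ?ler_pdivrMr; lra.
    - by rewrite -e0 eqxx in hz'.
  have := key _ s01.
  have -> : 1 - h z / (h z - h z') = - h z' / (h z - h z') by field.
  rewrite !scalerA mulrAC divff// mul1r [- h z' / _ / _]mulrAC mulNr divff//.
  rewrite mulN1r scaleNr -scalerBr => Sd.
  have Ad : vectors A ((h z - h z')^-1 *: (z - z')).
    by case: Sd => p [Ap _]; exists p.
  have /(cone_disjoint AL0 (or_intror Ad))/eqP : (h z - h z')^-1 *: (z - z') \in L.
    exact: memvZ.
  rewrite scaler_eq0 invr_eq0 (negPf d0) subr_eq0 => /eqP zz'.
  by rewrite zz' subrr eqxx in d0.
(* This is the value of [h] at the desired combination, nonzero because [h z] and [h z'] have the
   same sign. Dividing by it gives the weights [s] and [1 - s] in the chart of H. *)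
pose c := t * h z + (1 - t) * h z'.
have /andP[t0 t1] := t01.
have [s s01 [sE sE']] : exists2 s, 0 <= s <= 1 &
    t = c * (s / h z) /\ 1 - t = c * ((1 - s) / h z').
  have c0 : c != 0.
    have : 0 < c * h z.
      rewrite /c mulrDl.
      have h2 : 0 < h z * h z by rewrite -expr2 exprn_even_gt0.
      have [t_gt0|t_le0] := ltP 0 t.
        rewrite ltr_pwDl//; first by rewrite -mulrA mulr_gt0.
        by rewrite -mulrA mulr_ge0 ?subr_ge0// mulrC ltW.
      have -> : t = 0 by lra.
      by rewrite !mul0r add0r subr0 mul1r mulrC.
    by apply: contraTneq => ->; rewrite mul0r ltxx.
  have sE : 1 - t * h z / c = (1 - t) * h z' / c by rewrite /c; field.
  have pos (a u u' : R) : 0 <= a -> 0 < u * u' -> a <= 1 ->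
      0 <= a * u / (a * u + (1 - a) * u').
    move=> a0 uu' a1; have [u0|u0|u0] := ltgtP 0 u.
    - have u'0 : 0 < u' by rewrite -(pmulr_rgt0 _ u0).
      by rewrite divr_ge0 ?addr_ge0 ?mulr_ge0 ?subr_ge0// ltW.
    - have u'0 : u' < 0 by rewrite -(nmulr_rgt0 _ u0).
      have au : a * u <= 0 by rewrite mulr_ge0_le0// ltW.
      have au' : (1 - a) * u' <= 0 by rewrite mulr_ge0_le0 ?subr_ge0// ltW.
      by rewrite mulr_le0// invr_le0; lra.
    - by rewrite -u0 mul0r ltxx in uu'.
  exists (t * h z / c).
    rewrite pos//=; rewrite -subr_ge0 sE [X in _ / X]addrC.
    have := pos (1 - t) (h z') (h z).
    have -> : 1 - (1 - t) = t by ring.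
    by apply; rewrite ?subr_ge0// 1?mulrC//; lra.
  by rewrite sE; clearbody c; split; field; rewrite c0 ?hz ?hz'.
right; have := vectorsZ c (key s s01); rewrite scalerDr !scalerA -!mulrA -sE -sE'.
by case=> p [Ap _]; exists p.
Qed.

Lemma vectors_compl_projection A T (w : V) : w \notin T ->
  vectors (~` projection T A) w <-> ~ exists2 z, cone A z & z - w \in T.
Proof.
move=> wT; split.
  move=> [q Bq wq] [z Az zwT]; apply: Bq.
  have zT : z \notin T.
    by apply: contra wT => zT; rewrite -[w](subKr z) memvB.
  have z0 : z != 0 by apply: contraNneq zT => ->; exact: mem0v.
  have [p Ap zp] := cone_vectors Az z0.
  have zq : z \in val q.
    rewrite -[z](subrK w) memvD//.
    by case: (q) zwT => W /= /andP[/subvP TW _] /TW.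
  exists p; split=> //.
    by apply: contra zT => /subvP; apply.
  by rewrite (quotprojE zq zT) (RP_vline zp z0) addvC.
move=> nz.
have hW : (T <= T + <[w]>)%VS && (\dim (T + <[w]>)%VS == (\dim T).+1).
  by rewrite addvSl dimv_add_line ?eqxx.
have wW : w \in (T + <[w]>)%VS by rewrite (subvP (addvSr _ _))// memv_line.
exists (Sub (T + <[w]>)%VS hW : quotproj T) => //=.
move=> [p [Ap pT /= pE]]; move: wW; rewrite pE => /memv_addP[a ap [u uT wE]].
apply: nz; exists a; first by right; exists p.
by rewrite wE opprD addrA subrr sub0r memvN.
Qed.

(** The complement of the projection misses a hyperplane H containing T. The point of [e] belongs to
    that complement, since A misses L, so [e] is not in H. Hence H is the kernel of a form [h] with
    [h e = 1]; it vanishes on T, so it agrees with [phi] on L, and [fiber_max_sublinear] applies. *)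
Lemma L_concave_sublinear A L T (phi : {scalar V}) (e : V) (M : V -> R) :
  A `&` points L = set0 ->
  (forall v z z' t, 0 <= t <= 1 -> fiber L (cone A) v z ->
     fiber L (cone A) v z' -> fiber L (cone A) v (t *: z + (1 - t) *: z')) ->
  (T <= L)%VS -> (\dim T).+1 = \dim L ->
  proj_convex fullv (~` projection T A) ->
  (forall u, u \in T -> phi u = 0) -> e \in L -> phi e = 1 ->
  fiber_max L (cone A) phi M -> sublinear M.
Proof.
move=> AL0 cA TL dT [_ _ [H [TH dH BH0 [ o [_ oH cS]]]]] phiT eL phie.
have {}TH : (T <= H)%VS by case/andP: TH.
have eT : e \notin T by apply/negP => /phiT/eqP; rewrite phie oner_eq0.
have BH w : w \notin T -> w \in H -> ~ vectors (~` projection T A) w.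
  move=> wT wH [q Bq wq].
  suff : (~` projection T A `&` points H) q by rewrite BH0.
  by split=> //; rewrite /points/= (quotprojE wq wT) subv_add TH -memvE.
have eH : e \notin H.
  apply/negP => /(BH e eT); apply; apply/vectors_compl_projection => //.
  move=> [z Az zeT]; have zeL := subvP TL _ zeT.
  have zL : z \in L by rewrite -[z](subrK e) memvD.
  have z0 := cone_disjoint AL0 Az zL.
  by move/negP: eT; apply; rewrite -memvN -sub0r -z0.
have [h [he hH]] := dual_form eH.
have hT u : u \in T -> h u = 0 by move=> /(subvP TH)/hH.
have L_decomp u : u \in L -> u - phi u *: e \in T.
  by move=> uL; exact: hyperplane_decomp TL dT phiT eL phie uL.
have hL u : u \in L -> h u = phi u.
  move=> uL; have := hT _ (L_decomp u uL).
  by rewrite linearB [h (_ *: _)]linearZ/= he mulr1 => /subr0_eq.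
have hitsT w : hits L (cone A) phi w <-> exists2 z, cone A z & z - w \in T.
  split=> [[z [Az zwL] zE]|[z Az zwT]].
    exists z => //; have := L_decomp _ zwL.
    by rewrite linearB/= zE subrr scale0r subr0.
  exists z; first by split=> //; exact: subvP TL _ zwT.
  by apply: subr0_eq; rewrite -linearB; exact: phiT.
have hits_iff w : w \notin T ->
    (vectors (~` projection T A) w <-> ~ hits L (cone A) phi w).
  by move=> wT; rewrite hitsT; exact: vectors_compl_projection.
apply: (fiber_max_sublinear (@coneZ A) cA eL phie hL) => [w hw|v w t t01 hv hw].
  have wH : w \in H.
    have := hyperplane_decomp (subvf H) dH hH (memvf e) he (memvf w).
    by rewrite hw scale0r subr0.
  have [wT|wT] := boolP (w \in T).
    apply/hitsT; exists 0; first by left.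
    by rewrite sub0r memvN.
  by apply: contrapT => /(hits_iff w wT); exact: BH.
have nT u : h u = 1 -> u \notin T.
  by move=> hu; apply/negP => /hT/eqP; rewrite hu oner_eq0.
move=> /(hits_iff _ (nT _ hv)) Bv /(hits_iff _ (nT _ hw)) Bw.
apply/hits_iff; first by apply: nT; rewrite scalar_comb hv hw; ring.
exact: (chart_convex_level (subvf H) dH hH (memvf o) oH cS (memvf v)
  (memvf w) hv hw t01 Bv Bw).
Qed.

(** The double cone [phi * psi >= 0] in L consists of two opposite quadrants. If K met both, some
    positive combination of its vectors would vanish, and K would contain a line. The sign [s] tells
    which quadrant holds K. *)
Lemma half_cone_sign L (Delta : set (RP R n)) (K : set V) (phi psi : {scalar V}) :
  (forall u, u \in L -> phi u = 0 -> psi u = 0 -> u = 0) ->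
  (forall u, vectors Delta u -> u \in L /\ 0 <= phi u * psi u) ->
  half_cone Delta K ->
  exists2 s : R, s ^+ 2 = 1 & forall u, K u -> 0 <= s * phi u /\ 0 <= s * psi u.
Proof.
move=> sep hD [_ cK ZK noline KE].
have KD u : K u -> u \in L /\ 0 <= phi u * psi u.
  by move=> Ku; apply: hD; rewrite KE; left.
have KDD u w : K u -> K w -> K (u + w).
  move=> Ku Kw; have -> : u + w = 2 *: (2^-1 *: u + (1 - 2^-1) *: w).
    by apply/rowP => i; rewrite !mxE; field.
  by apply: ZK => //; apply: convex_setP cK _ Ku Kw; lra.
have [pos|/existsNP[u /not_implyP[Ku /not_andP nu]]] :=
    pselect (forall u, K u -> 0 <= phi u /\ 0 <= psi u).
  by exists 1; [rewrite expr1n|move=> u /pos; rewrite !mul1r].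
exists (- 1) => [|w Kw]; first by rewrite sqrrN expr1n.
have [uL u2] := KD _ Ku.
have [wL w2] := KD _ Kw.
have u_lt0 : phi u + psi u < 0.
  case: nu => /negP; rewrite -ltNge => h; nra.
have u_le0 : phi u <= 0 /\ psi u <= 0 by split; nra.
rewrite !mulN1r; apply: contrapT => nw.
have w_gt0 : 0 < phi w + psi w.
  rewrite ltNge; apply/negP => w_le0; apply: nw; split; nra.
(* At this point of the cone, phi and psi take opposite values. *)
pose s := phi w + psi w; pose t := - (phi u + psi u).
have s0 : 0 < s by [].
have t0 : 0 < t by rewrite oppr_gt0.
have Kz : K (s *: u + t *: w) by apply: KDD; apply: ZK => //; exact: ltW.
have [zL] := KD _ Kz; rewrite !scalar_comb => z2.
have zphi : s * phi u + t * phi w = - (s * psi u + t * psi w).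
  by rewrite /s /t; ring.
have psi0 : s * psi u + t * psi w = 0.
  by move: z2; rewrite zphi => z2; nra.
have /eqP : s *: u + t *: w = 0.
  by apply: sep => //; rewrite scalar_comb// zphi psi0 oppr0.
rewrite addr_eq0 => /eqP sutw.
have u0 : u = 0.
  apply: (noline 0) => r; rewrite add0r.
  have [r0|r0] := leP 0 r; first exact: ZK.
  have -> : r *: u = (- (r / s) * t) *: w.
    rewrite -scalerA -[t *: w]opprK -sutw scaleNr scalerN opprK scalerA.
    by rewrite divfK// lt0r_neq0.
  by apply: ZK => //; rewrite mulNr oppr_ge0 mulr_le0_ge0// ?pmulr_lle0 ?invr_gt0// ltW.
by move: u_lt0; rewrite u0 !linear0 addr0 ltxx.
Qed.

(** Since K lies in a quadrant, the two vertices of the pointed section are extremal for [phi] and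
    [psi] simultaneously. The sign of the quadrant and that of the factor between the cosets of [o]
    and [v] decide which vertex is the minimum. *)
Lemma pointed_corners A L N (Delta : set (RP R n)) (v : V)
    (phi psi : {scalar V}) :
  (L <= N)%VS -> (\dim L).+1 = \dim N -> v \in N -> v \notin L ->
  (forall u, u \in L -> phi u = 0 -> psi u = 0 -> u = 0) ->
  (forall u, vectors Delta u -> u \in L /\ 0 <= phi u * psi u) ->
  pointed N L Delta (A `&` points N) ->
  exists z1 z2, [/\ fiber L (cone A) v z1, fiber L (cone A) v z2 &
    forall z, fiber L (cone A) v z ->
      phi z1 <= phi z <= phi z2 /\ psi z1 <= psi z <= psi z2].
Proof.
move=> LN dL vN vL sep hD [_ _ [ o [K [oN oL hK [a [b [[aL Sa] [bL Sb] abP]]]]]]].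
have [sg sg1 KP] := half_cone_sign sep hD hK.
have [h [hv hL]] := dual_form vL.
(* Division by [c] carries the coset [o + L] of the chart onto the coset [v + L] of the fiber. *)
have [c c0 coL] : exists2 c, c != 0 & o - c *: v \in L.
  have ocL := hyperplane_decomp LN dL hL vN hv oN.
  exists (h o) => //; apply: contraNneq oL => ho.
  by move: ocL; rewrite ho scale0r subr0.
have inF u : u \in L -> vectors (A `&` points N) (o + u) ->
    fiber L (cone A) v (c^-1 *: (o + u)).
  move=> uL Su; split.
    by right; apply: vectorsZ; case: Su => p [Ap _]; exists p.
  have -> : c^-1 *: (o + u) - v = c^-1 *: ((o - c *: v) + u).
    by rewrite addrAC scalerBr scalerK.
  by rewrite memvZ// memvD.
have inC z : fiber L (cone A) v z -> chart L o (A `&` points N) (c *: z - o).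
  move=> [Az zvL]; split.
    have -> : c *: z - o = c *: (z - v) - (o - c *: v).
      by rewrite scalerBr opprB addrA subrK.
    by rewrite memvB// memvZ.
  have z0 : z != 0.
    by apply: contraNneq vL => z0; rewrite -memvN -sub0r -z0.
  rewrite addrC subrK; apply: vectorsZ; apply: vectors_section => //.
    by rewrite -[z](subrK v) memvD// (subvP LN).
  exact: cone_vectors.
have key f z : (f = phi \/ f = psi) -> fiber L (cone A) v z ->
    0 <= sg * (c * f z - f (o + a)) /\ 0 <= sg * (f (o + b) - c * f z).
  move=> fE /inC/abP[/KP[a1 a2] /KP[b1 b2]].
  have E1 : c * f z - f (o + a) = f (c *: z - o - a).
    by rewrite -addrA -opprD linearB [f (c *: z)]linearZ.
  have E2 : f (o + b) - c * f z = f (b - (c *: z - o)).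
    by rewrite opprB addrCA addrA linearB [f (c *: z)]linearZ.
  by rewrite E1 E2; case: fE => ->.
have sc0 : sg * c != 0.
  rewrite mulf_neq0//; apply: contra_eqN sg1 => /eqP->.
  by rewrite expr0n/= eq_sym oner_eq0.
have scale (f : {scalar V}) u : f (c^-1 *: u) = c^-1 * f u :> R by exact: linearZ.
have fin (f : {scalar V}) z u : 0 <= sg * (c * f z - f u) ->
    0 <= (sg * c) * (f z - f (c^-1 *: u)).
  by rewrite scale; congr (_ <= _); field.
have fin' (f : {scalar V}) z u : 0 <= sg * (f u - c * f z) ->
    0 <= (sg * c) * (f (c^-1 *: u) - f z).
  by rewrite scale; congr (_ <= _); field.
have FA := inF _ aL Sa; have FB := inF _ bL Sb.
have [sc|sc] := ltP 0 (sg * c).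
  exists (c^-1 *: (o + a)), (c^-1 *: (o + b)); split=> // z vz.
  have [/fin p1 /fin' p2] := key _ _ (or_introl erefl) vz.
  have [/fin p3 /fin' p4] := key _ _ (or_intror erefl) vz.
  by move: p1 p2 p3 p4; rewrite !pmulr_rge0// !subr_ge0 => -> -> -> ->.
have {}sc : sg * c < 0 by rewrite lt_neqAle sc0.
exists (c^-1 *: (o + b)), (c^-1 *: (o + a)); split=> // z vz.
have [/fin p1 /fin' p2] := key _ _ (or_introl erefl) vz.
have [/fin p3 /fin' p4] := key _ _ (or_intror erefl) vz.
by move: p1 p2 p3 p4; rewrite !nmulr_rge0// !subr_le0 => -> -> -> ->.
Qed.

(** A vector of L with coordinates of opposite signs is, up to sign, a positive combination of v and
    [- w], so a and b separate its point from c. *)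
Lemma interval_complement_sign L (a b c : RP R n) (v w : V)
    (phi psi : {scalar V}) :
  a != b -> val a = <[v]>%VS -> val b = <[w]>%VS -> open_segment v w c ->
  (forall u, u \in L -> u = phi u *: v + psi u *: w) ->
  forall u, vectors (points L `\` interval_avoiding a b c) u ->
    u \in L /\ 0 <= phi u * psi u.
Proof.
move=> ab aE bE cvw uE u [p [pL pI] up].
have uL : u \in L := subvP pL _ up.
split=> //; rewrite leNgt; apply/negP => lt0; apply: pI; split=> //.
exists v, w; split=> //.
have [phi0|phi0|phi0] := ltgtP 0 (phi u).
- exists (phi u), (- psi u); split=> //.
    by rewrite oppr_gt0 -(pmulr_rlt0 _ phi0).
  by rewrite scalerN scaleNr opprK -uE.
- exists (- phi u), (psi u); split; rewrite ?oppr_gt0//.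
    by rewrite -(nmulr_rlt0 _ phi0).
  by rewrite scalerN scaleNr -opprD -uE// memvN.
- by rewrite -phi0 mul0r ltxx in lt0.
Qed.

End ProjectiveSets.

(** * Coordinates on L adapted to the four points, and the subspace inside A *)

Lemma cyclic_order_coord (R : realType) (n : nat) (a1 a2 a3 a4 : RP R n) :
  cyclic_order a1 a2 a3 a4 -> exists (e1 e2 : 'rV[R]_n.+1) (mu : R),
    [/\ 0 < mu, val a1 = <[e1]>%VS, val a2 = <[e1 + e2]>%VS,
        val a3 = <[e2]>%VS & val a4 = <[e1 - mu *: e2]>%VS].
Proof.
move=> [_ [a13 [v [w [a1E a3E [s [t [s0 t0 st2]]] [s' [t' [s'0 t'0 st4]]]]]]]].
have vw (k l : R) : k != 0 -> k *: v + l *: w != 0.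
  move=> k0; apply: contraNneq a13 => /eqP; rewrite addr_eq0 => /eqP kv.
  apply/eqP/val_inj; rewrite [LHS]a1E [RHS]a3E; apply/eqP.
  rewrite eqEdim -memvE -[X in X \in _](scalerK k0) kv.
  rewrite memvZ ?memvN ?memvZ ?memv_line//= -a1E -a3E.
  by case: (a1) (a3) => [W /= /andP[_ /eqP->]] [W' /= /andP[_ /eqP->]].
(* The scaling makes the sum of the two vectors span a_2; the position of a_4 then leaves one
   positive parameter, a cross-ratio up to sign. *)
exists (s *: v), (t *: w), (t' * s / (t * s')); split.
- by rewrite divr_gt0 ?mulr_gt0.
- by rewrite a1E; apply: vline_scale; rewrite gt_eqF.
- by apply: RP_vline => //; apply: vw; rewrite gt_eqF.
- by rewrite a3E; apply: vline_scale; rewrite gt_eqF.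
- have -> : s *: v - (t' * s / (t * s')) *: (t *: w) =
      (s / s') *: (s' *: v + t' *: - w).
    by apply/rowP => i; rewrite !mxE; field; rewrite !gt_eqF.
  rewrite -vline_scale; last by rewrite mulf_neq0 ?invr_eq0 ?gt_eqF.
  by apply: RP_vline => //; rewrite scalerN -scaleNr; apply: vw; rewrite gt_eqF.
Qed.

Theorem mainTheorem5 (R : realType) (n : nat) (L : {vspace 'rV[R]_n.+1})
    (A : set (RP R n)) (a1 a2 a3 a4 : RP R n)
    (dimL : \dim L = 2%N)
    (convA : L_convex_concave L A)
    (a1L : points L a1) (a2L : points L a2)
    (a3L : points L a3) (a4L : points L a4)
    (cyc : cyclic_order a1 a2 a3 a4) :
  let I1 := points L `\` interval_avoiding a1 a2 a3 in
  let I2 := points L `\` interval_avoiding a2 a3 a4 in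
  let I3 := points L `\` interval_avoiding a3 a4 a1 in
  let I4 := points L `\` interval_avoiding a4 a1 a2 in
  (forall N : {vspace 'rV[R]_n.+1}, (L <= N)%VS -> \dim N = 3%N ->
     [/\ pointed N L I1 (A `&` points N), pointed N L I2 (A `&` points N),
         pointed N L I3 (A `&` points N) & pointed N L I4 (A `&` points N)]) ->
  exists2 M : {vspace 'rV[R]_n.+1}, (\dim M).+1 = n & points M `<=` A.
Proof.
move=> I1 I2 I3 I4 ptd.
have [_ AL0 Lconv Lconc] := convA.
have [a12 a23 a34 a41] : [/\ a1 != a2, a2 != a3, a3 != a4 & a4 != a1].
  have [+ _] := cyc; rewrite /= !inE !negb_or.
  move=> /and3P[/and3P[? _ ?] /andP[? _] /andP[? _]].
  by split=> //; rewrite eq_sym.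
have [e1 [e2 [mu [mu0 a1E a2E a3E a4E]]]] := cyclic_order_coord cyc.
have e1L : e1 \in L by rewrite memvE -a1E.
have e2L : e2 \in L by rewrite memvE -a3E.
have dimRP (p : RP R n) : \dim (val p) = 1%N.
  by case: p => W /= /andP[_ /eqP ->]; rewrite dimv0.
have e12 : e1 \notin <[e2]>%VS.
  apply/negP => e12; have [+ _] := cyc.
  suff -> : a1 = a3 by rewrite /= !inE eqxx !orbT.
  apply/val_inj/eqP; rewrite [X in X == _]a1E [X in _ == X]a3E eqEdim -memvE e12/=.
  by rewrite -a1E -a3E !dimRP.
have e20 : e2 != 0.
  by have := dimRP a3; rewrite a3E dim_vline; case: eqP.
have e21 : e2 \notin <[e1]>%VS.
  apply: contra e12 => /vlineP[k e2E]; apply/vlineP; exists k^-1.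
  rewrite e2E scalerK//; apply: contraNneq e20 => k0.
  by rewrite e2E k0 scale0r.
have [x [xe1 xe2']] := dual_form e12.
have [y [ye2 ye1']] := dual_form e21.
have xe2 : x e2 = 0 by apply: xe2'; exact: memv_line.
have ye1 : y e1 = 0 by apply: ye1'; exact: memv_line.
have L_coord u : u \in L -> u = x u *: e1 + y u *: e2.
  have e1L' : (<[e1]> <= L)%VS by rewrite -memvE.
  have dim1 : (\dim <[e1]>%VS).+1 = \dim L by rewrite -a1E dimRP dimL.
  move=> uL; have := hyperplane_decomp e1L' dim1 ye1' e2L ye2 uL.
  move=> /vlineP[k kE]; have uE : u = k *: e1 + y u *: e2 by rewrite -kE subrK.
  by rewrite {2}uE scalar_comb xe1 xe2 mulr1 mulr0 addr0.
pose Z := cone A.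
have fiber0 v z : v \in L -> fiber L Z v z -> z = 0.
  move=> vL [Az zv]; apply: (cone_disjoint AL0 Az).
  by rewrite -[z](subrK v) memvD.
have N_dim v : v \notin L -> \dim (L + <[v]>)%VS = (\dim L).+1.
  exact: dimv_add_line.
have cA v z z' t : 0 <= t <= 1 -> fiber L Z v z -> fiber L Z v z' ->
    fiber L Z v (t *: z + (1 - t) *: z').
  move=> t01 vz vz'; have [vL|vL] := boolP (v \in L).
    rewrite (fiber0 _ _ vL vz) (fiber0 _ _ vL vz') !scaler0 addr0.
    by split; [left|rewrite sub0r memvN].
  apply: (@L_convex_fiber _ _ _ _ (L + <[v]>)%VS) => //.
  - exact: addvSl.
  - by rewrite (subvP (addvSr _ _))// memv_line.
  - by apply: Lconv; [exact: addvSl|exact: N_dim].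
(* As L is a line, its point a is a center of projection of dimension [dim L - 1], and concavity
   applies to the forms vanishing at a. *)
have sub (a : RP R n) u e (phi : {scalar 'rV[R]_n.+1}) M : points L a ->
    val a = <[u]>%VS -> phi u = 0 -> e \in L -> phi e = 1 ->
    fiber_max L Z phi M -> sublinear M.
  move=> aL aE phiu eL phie.
  have dT : (\dim (val a)).+1 = \dim L by rewrite dimRP dimL.
  have [_ cB] := Lconc _ aL dT.
  apply: (L_concave_sublinear AL0 cA aL dT cB _ eL phie) => w.
  by rewrite aE => /vlineP[k ->]; rewrite linearZ/= phiu mulr0.
have corn (a b c : RP R n) v w (phi psi : {scalar 'rV[R]_n.+1}) :
    a != b -> val a = <[v]>%VS -> val b = <[w]>%VS -> open_segment v w c ->
    (forall u, u \in L -> u = phi u *: v + psi u *: w) ->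
    (forall N, (L <= N)%VS -> \dim N = 3%N ->
      pointed N L (points L `\` interval_avoiding a b c) (A `&` points N)) ->
    corners L Z phi psi.
  move=> ab aE bE cvw uE pt v'; have [vL|vL] := boolP (v' \in L).
    exists 0, 0; split=> [||z vz].
    - by split; [left|rewrite sub0r memvN].
    - by split; [left|rewrite sub0r memvN].
    - by rewrite (fiber0 _ _ vL vz) !lexx.
  have LN : (L <= L + <[v']>)%VS := addvSl _ _.
  have dN := N_dim _ vL.
  apply: (pointed_corners LN (esym dN) _ vL _ _ (pt _ LN _)).
  - by rewrite (subvP (addvSr _ _))// memv_line.
  - by move=> u uL p0 q0; rewrite (uE u uL) p0 q0 !scale0r addr0.
  - exact: interval_complement_sign ab aE bE cvw uE.
  - by rewrite dN dimL.
have muN : mu != 0 by rewrite gt_eqF.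
have swap (phi psi : {scalar 'rV[R]_n.+1}) : corners L Z phi psi -> corners L Z psi phi.
  move=> c v; have [z1 [z2 [h1 h2 h]]] := c v.
  by exists z1, z2; split=> // z /h[].
(* For each segment, the vectors spanning the two endpoints are scaled so that the third point lies
   on their positive combinations; the coordinates of L in this basis are the two forms of the
   corners. *)
have c1 : corners L Z y (lincomb y x 1 (- 1)).
  apply: swap; apply: (corn a1 a2 a3 (- e1) (e1 + e2)) => //.
  - by rewrite -scaleN1r -vline_scale// oppr_eq0 oner_eq0.
  - exists 1, 1; split=> //; rewrite !scale1r addKr a3E.
    exact: memv_line.
  - move=> u /L_coord; rewrite /= /lincomb; set p := x u; set q := y u => ->.
    by apply/rowP => i; rewrite !mxE; ring.
  - by move=> N LN dN; have [] := ptd N LN dN.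
have c2 : corners L Z x (lincomb x y 1 (- 1)).
  apply: (corn a2 a3 a4 (e1 + e2) (- e2)) => //.
  - by rewrite -scaleN1r -vline_scale// oppr_eq0 oner_eq0.
  - exists 1, (1 + mu); split=> //; first by rewrite addr_gt0.
    suff -> : 1 *: (e1 + e2) + (1 + mu) *: - e2 = e1 - mu *: e2.
      by rewrite a4E memv_line.
    by apply/rowP => i; rewrite !mxE; ring.
  - move=> u /L_coord; rewrite /= /lincomb; set p := x u; set q := y u => ->.
    by apply/rowP => i; rewrite !mxE; ring.
  - by move=> N LN dN; have [] := ptd N LN dN.
have c3 : corners L Z x (lincomb x y mu 1).
  apply: swap; apply: (corn a3 a4 a1 e2 (e1 - mu *: e2)) => //.
  - exists mu, 1; split=> //; rewrite scale1r addrCA subrr addr0 a1E.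
    exact: memv_line.
  - move=> u /L_coord; rewrite /= /lincomb; set p := x u; set q := y u => ->.
    by apply/rowP => i; rewrite !mxE; ring.
  - by move=> N LN dN; have [] := ptd N LN dN.
have c4 : corners L Z y (lincomb x y mu 1).
  apply: (corn a4 a1 a2 (- mu^-1 *: (e1 - mu *: e2)) (mu^-1 *: e1)) => //.
  - by rewrite -vline_scale// oppr_eq0 invr_eq0.
  - by rewrite -vline_scale// invr_eq0.
  - exists 1, (mu + 1); split=> //; first by rewrite addr_gt0.
    suff -> : 1 *: (- mu^-1 *: (e1 - mu *: e2)) + (mu + 1) *: (mu^-1 *: e1) =
        e1 + e2 by rewrite a2E memv_line.
    by apply/rowP => i; rewrite !mxE; field.
  - move=> u /L_coord; rewrite /= /lincomb; set p := x u; set q := y u => ->.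
    by apply/rowP => i; rewrite !mxE; field.
  - by move=> N LN dN; have [] := ptd N LN dN.
have x_sub := sub a3 e2 e1 x _ a3L a3E xe2 e1L xe1.
have y_sub := sub a1 e1 e2 y _ a1L a1E ye1 e2L ye2.
have D_sub M : fiber_max L Z (lincomb y x 1 (- 1)) M -> sublinear M.
  apply: (sub a2 (e1 + e2) e2 _ _ a2L a2E _ e2L); rewrite /= /lincomb.
    by rewrite [x _]linearD [y _]linearD xe1 ye1 xe2 ye2; ring.
  by rewrite xe2 ye2; ring.
have E_sub M : fiber_max L Z (lincomb x y mu 1) M -> sublinear M.
  apply: (sub a4 (e1 - mu *: e2) e2 _ _ a4L a4E _ e2L); rewrite /= /lincomb.
    rewrite -[e1]scale1r -scaleNr !scalar_comb xe1 ye1 xe2 ye2; ring.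
  by rewrite xe2 ye2; ring.
have [f [g fgZ]] := linear_selection (@coneZ R n A) cA mu0 L_coord c1 c2 c3 c4
  x_sub y_sub D_sub E_sub.
(* This map keeps v modulo L and replaces its coordinates [x v] and [y v] by [f v] and [g v]. *)
pose G v := v + ((f v - x v) *: e1 + (g v - y v) *: e2).
have G_lin : linear G.
  move=> k u v; rewrite /G [f _]linearP [g _]linearP [x _]linearP [y _]linearP.
  by apply/rowP => i; rewrite !mxE; ring.
pose G' : {linear 'rV[R]_n.+1 -> 'rV[R]_n.+1} :=
  HB.pack G (GRing.isLinear.Build _ _ _ _ G G_lin).
have GE v : linfun G' v = G v by rewrite lfunE.
(* Since [G v] is v modulo L, a zero of G lies in L. Conversely G maps L into the fiber over L,
   which is 0 because A misses L. *)
have kerG : lker (linfun G') = L.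
  apply/vspaceP => v; rewrite memv_ker GE.
  have GvL : G v - v \in L by rewrite /G addrC addKr memvD ?memvZ.
  apply/eqP/idP => [Gv0|vL]; first by rewrite -memvN -sub0r -Gv0.
  by apply: (fiber0 v _ vL); split=> //; exact: fgZ.
(* The rank is [n + 1 - 2 = n - 1], so the image has projective dimension [n - 2]. *)
exists (limg (linfun G')).
  have := limg_ker_dim (linfun G') fullv.
  by rewrite capfv kerG dimL dimvf /dim/= mul1n add2n => -[].
move=> p pM; have [z zp z0] := RP_nonzero p.
have /memv_imgP[v _ zE] : z \in limg (linfun G') := subvP pM _ zp.
have [|q Aq zq] := @cone_vectors _ _ A z _ z0.
  by rewrite zE GE; exact: fgZ.
by rewrite (quotproj_inj _ zp zq)// memv0.
Qed.
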